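(* Let $X$ be a strictly convex real Banach space such that $\dim(X)\geq 2$ and such that the set $Sm(X)$ of smooth points of $X$ is norm dense in $S_X$, and let $K$ be a totally disconnected locally compact Hausdorff space with $|K|\geq 2$. Then $C_0(K,X)$ satisfies the Mazur--Ulam property.
   Context: All Banach spaces are real. $C_0(K,X)$ is the Banach space of continuous functions $f:K\to X$ vanishing at infinity (for every $\varepsilon>0$ there is a compact $K_\varepsilon\subseteq K$ with $\|f(t)\|<\varepsilon$ off $K_\varepsilon$), with the sup norm. A Banach space is strictly convex if every point of its unit sphere is an extreme point of its closed unit ball. A point $x\in S_X$ is a smooth point if there is a unique $f\in S_{X^*}$ with $f(x)=1$. A Banach space $Z$ satisfies the Mazur--Ulam property if for every Banach space $Y$, every surjective isometry $\Delta:S_Z\to S_Y$ between the unit spheres admits an extension to a surjective real-linear isometry from $Z$ onto $Y$. *)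

(* Defs.v *)
From HB Require Import structures.
From mathcomp Require Import all_boot all_order all_algebra.
From mathcomp Require Import all_classical all_reals all_analysis.
Unset Printing Implicit Defensive.
Import Order.TTheory GRing.Theory Num.Theory numFieldNormedType.Exports.
Local Open Scope classical_set_scope.
Local Open Scope ring_scope.

Section Defs.
Context {R : realType}.

Definition unit_ball (X : normedModType R) : set X := [set x | `|x| <= 1].
Definition unit_sphere (X : normedModType R) : set X := [set x | `|x| = 1].

Definition extreme_point (X : normedModType R) (C : set X) (x : X) :=
  C x /\ forall (y z : X) (t : R), C y -> C z -> 0 < t < 1 ->
    x = t *: y + (1 - t) *: z -> y = z.

Definition strictly_convex (X : normedModType R) :=
  forall x : X, unit_sphere X x -> extreme_point X (unit_ball X) x.

Definition lin_functional (X : normedModType R) (f : X -> R) :=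
  forall (a : R) (u v : X), f (a *: u + v) = a * f u + f v.

Definition op_norm (X : normedModType R) (f : X -> R) : R :=
  sup [set `|f x| | x in unit_ball X].

Definition dual_sphere (X : normedModType R) (f : X -> R) :=
  lin_functional X f /\ continuous f /\ op_norm X f = 1.

Definition smooth_point (X : normedModType R) (x : X) :=
  unit_sphere X x /\ exists! f : X -> R, dual_sphere X f /\ f x = 1.

Definition smooth_points_dense (X : normedModType R) :=
  forall x : X, unit_sphere X x -> forall eps : R, 0 < eps ->
    exists y : X, smooth_point X y /\ `|x - y| < eps.

Definition dim_ge2 (X : normedModType R) :=
  exists x y : X, forall a b : R, a *: x + b *: y = 0 -> a = 0 /\ b = 0.

Definition C0 (K : topologicalType) (X : normedModType R) : set (K -> X) :=
  [set f | continuous f /\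
    forall eps : R, 0 < eps -> exists C : set K,
      compact C /\ forall t, ~ C t -> `|f t| < eps].

Definition supnorm (K : Type) (X : normedModType R) (f : K -> X) : R :=
  sup [set `|f t| | t in [set: K]].

Definition C0_sphere (K : topologicalType) (X : normedModType R) : set (K -> X) :=
  [set f | C0 K X f /\ supnorm K X f = 1].

Definition C0_MazurUlam (K : topologicalType) (X : normedModType R) :=
  forall (Y : completeNormedModType R) (D : (K -> X) -> Y),
    (forall f, C0_sphere K X f -> unit_sphere Y (D f)) ->
    (forall f g, C0_sphere K X f -> C0_sphere K X g ->
        `|D f - D g| = supnorm K X (fun t => f t - g t)) ->
    (forall y : Y, unit_sphere Y y -> exists2 f, C0_sphere K X f & D f = y) ->
    exists T : (K -> X) -> Y,
      [/\ (forall (a : R) f g, C0 K X f -> C0 K X g ->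
              T (fun t => a *: f t + g t) = a *: T f + T g),
          (forall f g, C0 K X f -> C0 K X g ->
              `|T f - T g| = supnorm K X (fun t => f t - g t)),
          (forall y : Y, exists2 f, C0 K X f & T f = y) &
          (forall f, C0_sphere K X f -> T f = D f)].

End Defs.

(* Main.v *)
Require Import Defs.
From HB Require Import structures.
From mathcomp Require Import all_boot all_order all_algebra.
From mathcomp Require Import all_classical all_reals all_analysis.
From mathcomp Require Import ring lra.
Import Order.TTheory GRing.Theory Num.Theory numFieldNormedType.Exports.
Local Open Scope classical_set_scope.
Local Open Scope ring_scope.

(* The homogeneous extension T of the sphere isometry D is linear because
   Y is separated by functionals phi with phi (T f) = xs (f t), where t is a point
   of K, x is a smooth point of X and xs is its support functional.

   As K has a base of compact open sets, functions may be made constant near a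
   given point.  If phi equals 1 on D(F) and -1 on D(-F) for the face
   F = {g | g t = x}, comparing f with members of -F gives
   phi (D f) <= |f t + x| - 1.  Such phi exist: with p = x on a small clopen set
   and 0 elsewhere, any w at distance 2 from -D p and from D (-p) is at distance
   2 from -D g and from D (-g) for each g equal to x on that set, so convex
   combinations of the images have norm 1, and Hahn-Banach applies.

   Let |f s| = 1 for some s <> t, and let g be x near t and f elsewhere.  The
   segment from D f to D g stays in the sphere, and by strict convexity of X its
   points are images of functions whose value at t lies on the segment from f t
   to x.  Applying the bound above near D g makes |M x + f t| - M appear with M
   large; smoothness of x then forces phi (D f) = xs (f t).  An f attaining its
   norm only at t is, up to a small error, a convex combination of two functions
   that also attain it elsewhere; strict convexity shows that D respects this
   combination. *)

(** * Sublinear functionals *)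
Section HahnBanach.
Context {R : realType} {V : lmodType R}.
Implicit Types (p q : V -> R) (G : V -> R -> Prop).

Definition sublinear p :=
  (forall x y, p (x + y) <= p x + p y) /\
  (forall c x, 0 < c -> p (c *: x) <= c * p x).

Definition linear_form p := forall (a : R) u v, p (a *: u + v) = a * p u + p v.

(** [G u a] stands for the demand [a <= f u] on a linear form [f] to be found. *)
Definition convex_cone G :=
  [/\ G 0 0, (forall u v a b, G u a -> G v b -> G (u + v) (a + b)) &
      (forall c u a, 0 < c -> G u a -> G (c *: u) (c * a))].

Lemma sublinear0 p : sublinear p -> p 0 = 0.
Proof.
move=> [_ pZ]; apply/eqP; rewrite eq_le; apply/andP; split.
  by have := pZ 2^-1 0; rewrite scaler0 => /(_ ltac:(lra)); lra.
by have := pZ 2 0; rewrite scaler0 => /(_ ltac:(lra)); lra.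
Qed.

Lemma sublinear_geN p x : sublinear p -> - p (- x) <= p x.
Proof.
move=> sp; have [+ _] := sp; move=> /(_ x (- x)).
by rewrite subrr sublinear0//; lra.
Qed.

Lemma le_inf_add (A B : set R) (l : R) : A !=set0 -> B !=set0 ->
  (forall a b, A a -> B b -> l <= a + b) -> l <= inf A + inf B.
Proof.
move=> A0 B0 AB; rewrite -lerBlDr; apply: lb_le_inf => // a Aa.
rewrite lerBlDr -lerBlDl; apply: lb_le_inf => // b Bb.
by rewrite lerBlDl; exact: AB.
Qed.

Lemma le_inf_scale (A : set R) (c l : R) : A !=set0 -> 0 < c ->
  (forall a, A a -> l <= c * a) -> l <= c * inf A.
Proof.
move=> A0 c0 Al; rewrite mulrC -ler_pdivrMr//; apply: lb_le_inf => // a Aa.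
by rewrite ler_pdivrMr// mulrC; exact: Al.
Qed.

(** Under the hypotheses below, the linear forms below [cone_inf q G] are exactly those below [q]
    that meet every demand in [G]. *)
Definition cone_inf q G (y : V) : R :=
  inf [set r | exists u a, G u a /\ r = q (y + u) - a].

Section cone_inf.
Variables (q : V -> R) (G : V -> R -> Prop).
Hypotheses (sq : sublinear q) (cG : convex_cone G).
Hypothesis Gq : forall u a, G u a -> a <= q u.

Lemma cone_inf_le y u a : G u a -> cone_inf q G y <= q (y + u) - a.
Proof.
move=> Gua; apply: ge_inf; last by exists u, a.
(* Lower bound of the set, from [a <= q u <= q (y + u) + q (- y)]. *)
exists (- q (- y)) => _ [v [b [Gvb ->]]].
have [+ _] := sq; move=> /(_ (y + v) (- y)).
by rewrite addrC addKr; have := Gq _ _ Gvb; lra.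
Qed.

Lemma cone_inf_n0 y : [set r | exists u a, G u a /\ r = q (y + u) - a] !=set0.
Proof. by case: cG => G0 _ _; exists (q (y + 0) - 0), 0, 0. Qed.

Lemma cone_inf_sublinear : sublinear (cone_inf q G).
Proof.
case: cG => _ GD GZ; have [qD qZ] := sq; split=> [x y|c x c0].
  apply: le_inf_add; [exact: cone_inf_n0|exact: cone_inf_n0|].
  move=> _ _ [u [a [ua ->]]] [v [b [vb ->]]].
  apply: (le_trans (cone_inf_le _ _ _ (GD _ _ _ _ ua vb))).
  by rewrite addrACA; have := qD (x + u) (y + v); lra.
apply: le_inf_scale => // [|_ [u [a [ua ->]]]]; first exact: cone_inf_n0.
apply: (le_trans (cone_inf_le _ _ _ (GZ _ _ _ c0 ua))).
by rewrite -scalerDr; have := qZ _ (x + u) c0; lra.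
Qed.

Lemma cone_inf_id y : cone_inf q G y <= q y.
Proof. by case: cG => G0 _ _; have := cone_inf_le y _ _ G0; rewrite addr0 subr0. Qed.

Lemma cone_infN u a : G u a -> cone_inf q G (- u) <= - a.
Proof.
by move=> ua; have := cone_inf_le (- u) _ _ ua; rewrite addNr sublinear0// sub0r.
Qed.

End cone_inf.

Lemma ray_cone u (a : R) :
  convex_cone (fun v b => exists2 c, 0 <= c & v = c *: u /\ b = c * a).
Proof.
split=> [|v w b b' [c c0 [-> ->]] [d d0 [-> ->]]|c v b c0 [d d0 [-> ->]]].
- by exists 0 => //; rewrite scale0r mul0r.
- by exists (c + d); [exact: addr_ge0|rewrite scalerDl mulrDl].
- by exists (c * d); [rewrite mulr_ge0// ltW|rewrite scalerA mulrA].
Qed.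

(** Minimality is tested against [cone_inf] for the ray through [(y, q y)]: it lies below [q], hence
    equals [q], which yields [q x <= q (x + y) - q y]. *)
Lemma minimal_sublinear_linear q : sublinear q ->
  (forall q', sublinear q' -> (forall y, q' y <= q y) -> q' = q) ->
  linear_form q.
Proof.
move=> sq qmin; have [qD qZ] := sq.
have qZ' c x : 0 <= c -> q (c *: x) = c * q x.
  rewrite le_eqVlt => /predU1P[<-|c0]; first by rewrite scale0r mul0r sublinear0.
  apply/eqP; rewrite eq_le qZ//=.
  have := qZ c^-1 (c *: x); rewrite invr_gt0 scalerA mulVf ?gt_eqF// scale1r.
  by move=> /(_ c0); rewrite mulrC ler_pdivlMr// mulrC.
have qD' x y : q (x + y) = q x + q y.
  apply/eqP; rewrite eq_le qD/=.
  pose G v b := exists2 c : R, 0 <= c & v = c *: y /\ b = c * q y.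
  have cG : convex_cone G by exact: ray_cone.
  have Gq u a : G u a -> a <= q u by move=> [c c0 [-> ->]]; rewrite qZ'.
  have <- : cone_inf q G x = q x.
    have -> // : cone_inf q G = q.
    by apply: qmin; [exact: cone_inf_sublinear|exact: cone_inf_id].
  rewrite -lerBrDr; apply: cone_inf_le => //.
  by exists 1 => //; rewrite scale1r mul1r.
have qN x : q (- x) = - q x.
  by apply/eqP; rewrite -addr_eq0 -qD' addNr sublinear0.
move=> a u v; rewrite qD'; congr (_ + _).
have [a0|a0] := leP 0 a; first exact: qZ'.
by rewrite -[a *: u]opprK -scaleNr qN qZ' ?oppr_ge0 1?ltW// mulNr opprK.
Qed.

Lemma sublinear_minorant p : sublinear p ->
  exists2 f, linear_form f & forall y, f y <= p y.
Proof.
move=> sp.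
pose T := {q : V -> R | sublinear q /\ forall y, q y <= p y}.
(* The order is reversed, so that a maximal element in Zorn's lemma is a minimal sublinear
   functional. *)
pose r (s t : T) : bool := `[< forall y, sval t y <= sval s y >].
have [|a b c /asboolP ab /asboolP bc|a b /asboolP ab /asboolP ba||q qmin] := @Zorn T r.
- by move=> t; exact/asboolP.
- by apply/asboolP => y; exact: le_trans (bc y) (ab y).
- move: a b ab ba => [a pa] [b pb] /= ab ba.
  have eab : a = b by apply/funext => y; apply/eqP; rewrite eq_le ab ba.
  by subst b; congr exist; exact: Prop_irrelevance.
- move=> A Atot.
  have [[q0 Aq0]|A0] := pselect (A !=set0); last first.
    exists (exist _ p (conj sp (fun=> lexx _))) => s As.
    by exfalso; apply: A0; exists s.
  pose q y := inf [set sval s y | s in A].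
  have qn0 y : [set sval s y | s in A] !=set0 by exists (sval q0 y), q0.
  have qle y s : A s -> q y <= sval s y.
    move=> As; apply: ge_inf; last by exists s.
    exists (- p (- y)) => _ [t At <-]; have [st tp] := svalP t.
    by apply: le_trans (sublinear_geN _ _ st); rewrite lerN2.
  have sq : sublinear q.
    split=> [x y|c x c0].
      apply: le_inf_add => // _ _ [s As <-] [t At <-].
      have [[sD _] _] := svalP s; have [[tD _] _] := svalP t.
      (* The chain is total, so the pointwise smaller of [s] and [t] serves for both summands. *)
      have [/asboolP st|/asboolP ts] := Atot s t As At.
        apply: (le_trans (qle _ _ At)); apply: (le_trans (tD _ _)).
        by rewrite lerD2r.
      apply: (le_trans (qle _ _ As)); apply: (le_trans (sD _ _)).
      by rewrite lerD2l.
    apply: le_inf_scale => // _ [s As <-]; have [[_ sZ] _] := svalP s.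
    exact: le_trans (qle _ _ As) (sZ _ _ c0).
  have qp y : q y <= p y.
    by apply: le_trans (qle y _ Aq0) _; have [_] := svalP q0.
  by exists (exist _ q (conj sq qp)) => s As; apply/asboolP => y; exact: qle.
have [sq qp] := svalP q.
exists (sval q) => //; apply: minimal_sublinear_linear => // q' sq' q'q.
have q'p y : q' y <= p y by exact: le_trans (q'q y) (qp y).
have <- // := qmin (exist _ q' (conj sq' q'p)).
exact/asboolP.
Qed.

Lemma hahn_banach_cone q G : sublinear q -> convex_cone G ->
  (forall u a, G u a -> a <= q u) ->
  exists f, [/\ linear_form f, forall y, f y <= q y &
                forall u a, G u a -> a <= f u].
Proof.
move=> sq cG Gq.
have [f lf fq] := sublinear_minorant _ (cone_inf_sublinear q G sq cG Gq).
exists f; split => // [y|u a Gua].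
  exact: le_trans (fq y) (cone_inf_id _ _ sq cG Gq y).
rewrite -lerN2.
have f0 : f 0 = 0 by have := lf 1 0 0; rewrite scale1r addr0; lra.
have -> : - f u = f (- u) by have := lf (-1) u 0; rewrite scaleN1r addr0; lra.
exact: le_trans (fq _) (cone_infN _ _ sq Gq _ _ Gua).
Qed.

End HahnBanach.

(** * Smoothness and strict convexity *)
Section NormedSpaces.
Context {R : realType} {X : normedModType R}.
Implicit Types (x y u v : X) (f : X -> R).

Lemma linear_form0 f : linear_form f -> f 0 = 0.
Proof. by move=> lf; have := lf 1 0 0; rewrite scale1r addr0; lra. Qed.

Lemma linear_formZ f a u : linear_form f -> f (a *: u) = a * f u.
Proof. by move=> lf; have := lf a u 0; rewrite (linear_form0 _ lf) !addr0. Qed.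

Lemma linear_formN f u : linear_form f -> f (- u) = - f u.
Proof. by move=> lf; rewrite -scaleN1r linear_formZ// mulN1r. Qed.

Lemma linear_formB f u v : linear_form f -> f (u - v) = f u - f v.
Proof.
by move=> lf; have := lf (-1) v u; rewrite scaleN1r addrC => ->; lra.
Qed.

Lemma norm_sublinear : sublinear (fun x : X => `|x|).
Proof.
by split=> [x y|c x c0]; [exact: ler_normD|rewrite normrZ gtr0_norm].
Qed.

Lemma form_norm_le f u : linear_form f -> (forall y, f y <= `|y|) ->
  `|f u| <= `|u|.
Proof.
by move=> lf fn; rewrite ler_norml fn andbT lerNl -linear_formN// -(normrN u).
Qed.

Lemma dual_sphereP f x : linear_form f -> (forall y, f y <= `|y|) ->
  `|x| = 1 -> 1 <= f x -> dual_sphere X f /\ f x = 1.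
Proof.
move=> lf fn x1 fx.
have fx1 : f x = 1 by apply/eqP; rewrite eq_le fx -x1 fn.
split=> //; split; [exact: lf|split].
  move=> u; apply/cvgrPdist_lt => e e0; near=> w.
  rewrite -linear_formB//; apply: le_lt_trans (form_norm_le _ _ lf fn) _.
  by near: w; exact: cvgr_dist_lt.
apply/eqP; rewrite eq_le; apply/andP; split.
  apply: ge_sup; first by exists `|f 0|, 0 => //; rewrite /unit_ball /= normr0.
  by move=> _ [u u1 <-]; apply: le_trans (form_norm_le _ _ lf fn) _.
apply: sup_upper_bound; last by exists x; rewrite ?fx1 ?normr1// /unit_ball /= x1.
split; first by exists `|f 0|, 0 => //; rewrite /unit_ball /= normr0.
by exists 1 => _ [u u1 <-]; apply: le_trans (form_norm_le _ _ lf fn) _.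
Unshelve. all: by end_near. Qed.

(* The last clause bounds [xs] below by the one-sided derivative of the norm
   at [x]: [`|M *: x + v| - M] decreases to it as [M] tends to infinity. *)
Definition smooth_support x (xs : X -> R) :=
  [/\ linear_form xs, forall y, xs y <= `|y|, xs x = 1 &
      forall v a, (forall M, 0 <= M -> a <= `|M *: x + v| - M) -> a <= xs v].

(** The demands [1 <= g x] and [a <= g v] span a cone compatible with the norm, by the assumed bound
    at [M = c / d]. Hahn-Banach gives a support functional [g] at [x] with [a <= g v], and
    uniqueness identifies it with [f]. *)
Lemma smooth_pointP x : smooth_point X x -> exists f, smooth_support x f.
Proof.
move=> [x1 [f [[df fx1] funiq]]].
have key v a : (forall M, 0 <= M -> a <= `|M *: x + v| - M) ->
    [/\ linear_form f, forall y, f y <= `|y| & a <= f v].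
  move=> av.
  pose G u b := exists c d : R, [/\ 0 <= c, 0 <= d, u = c *: x + d *: v &
    b = c + d * a].
  have [] := @hahn_banach_cone _ _ (fun y : X => `|y|) G norm_sublinear.
  - split=> [|_ _ _ _ [c [d [c0 d0 -> ->]]] [c' [d' [c0' d0' -> ->]]]|
             e _ _ e0 [c [d [c0 d0 -> ->]]]].
    + by exists 0, 0; rewrite !scale0r mul0r !addr0.
    + exists (c + c'), (d + d'); split; [exact: addr_ge0|exact: addr_ge0| |].
        by rewrite !scalerDl addrACA.
      by rewrite mulrDl addrACA.
    + exists (e * c), (e * d); split; [| | |].
      * by rewrite mulr_ge0// ltW.
      * by rewrite mulr_ge0// ltW.
      * by rewrite scalerDr !scalerA.
      * by rewrite mulrDr mulrA.
  - move=> _ _ [c [d [c0 d0 -> ->]]].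
    move: d0; rewrite le_eqVlt => /predU1P[<-|d0].
      by rewrite scale0r mul0r !addr0 normrZ x1 mulr1 ler_norm.
    have -> : c *: x + d *: v = d *: ((c / d) *: x + v).
      by rewrite scalerDr scalerA mulrCA mulfV ?gt_eqF// mulr1.
    rewrite normrZ gtr0_norm//; have := av (c / d) (divr_ge0 c0 (ltW d0)).
    rewrite -(ler_pM2l d0) mulrBr mulrCA mulfV ?gt_eqF// mulr1.
    by rewrite lerBrDr addrC.
  move=> g [lg gn gG].
  have gx : 1 <= g x.
    by apply: gG; exists 1, 0; rewrite scale1r scale0r mul0r !addr0.
  have gv : a <= g v.
    by apply: gG; exists 0, 1; rewrite scale1r scale0r mul1r !add0r.
  by rewrite (funiq _ (dual_sphereP _ _ lg gn x1 gx)).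
(* The trivial case of [key] already yields the pointwise bound of [f] by the norm, without
   unfolding [op_norm]. *)
exists f; have [|lf fn _] := key 0 0.
  by move=> M M0; rewrite addr0 normrZ x1 mulr1 ger0_norm// subrr.
by split => // v a /key[].
Qed.

(** Lower bounds on this difference established for large coefficients thereby pass to all real
    ones. *)
Lemma norm_addZ_le x v (M N : R) : `|x| = 1 -> M <= N ->
  `|N *: x + v| - N <= `|M *: x + v| - M.
Proof.
move=> x1 MN; have -> : N *: x + v = (N - M) *: x + (M *: x + v).
  by rewrite addrA -scalerDl subrK.
have := ler_normD ((N - M) *: x) (M *: x + v).
by rewrite normrZ x1 mulr1 ger0_norm ?subr_ge0//; lra.
Qed.

(** For [a <= b], the triangle inequality is applied to [b *: (u + v) = (a *: u + b *: v) + (b - a)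
    *: u]; the other case is symmetric. *)
Lemma norm_add_scale u v (a b : R) : 0 <= a -> 0 <= b ->
  `|u| + `|v| <= `|u + v| -> a * `|u| + b * `|v| <= `|a *: u + b *: v|.
Proof.
wlog ab : u v a b / a <= b => [H a0 b0 uv|].
  have [|/ltW ba] := leP a b; first by move=> ab; exact: H.
  by rewrite addrC [in leRHS]addrC; apply: H => //; rewrite addrC [in leRHS]addrC.
move=> a0 b0 uv.
have := ler_normD (a *: u + b *: v) ((b - a) *: u).
have -> : a *: u + b *: v + (b - a) *: u = b *: (u + v).
  by rewrite addrAC -scalerDl (addrC a) subrK [RHS]scalerDr.
rewrite !normrZ (ger0_norm b0) ger0_norm ?subr_ge0//.
by have := ler_wpM2l b0 uv; rewrite mulrDr mulrBl; lra.
Qed.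

Section StrictConvexity.
Hypothesis scX : strictly_convex X.

Lemma strictly_convex_norm_add u v : `|u| <= 1 -> `|v| <= 1 -> 2 <= `|u + v| ->
  u = v.
Proof.
move=> u1 v1 uv.
have w1 : `|2^-1 *: (u + v)| = 1.
  rewrite normrZ gtr0_norm//; have := ler_normD u v; lra.
have [_ ext] := scX _ w1.
apply: (ext u v 2^-1) => //; first by lra.
by rewrite scalerDr; congr (_ + _ *: _); lra.
Qed.

(** If [u] and [v] differ, the normalised [u - v] is a unit vector and a convex combination of [p]
    and [q], which are [u - w] and [w - v] rescaled into the unit ball. Extremality gives [p = q],
    which puts [w] on the segment. *)
Lemma strictly_convex_between u v w (a b : R) : 0 < a -> 0 < b ->
  `|w - u| <= b * `|u - v| -> `|w - v| <= a * `|u - v| -> a + b = 1 ->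
  w = a *: u + b *: v.
Proof.
move=> a0 b0 wu wv ab1.
have [/eqP|uv] := eqVneq u v.
  rewrite -subr_eq0 => /eqP uv0; move: wu wv; rewrite uv0 normr0 !mulr0.
  rewrite !normr_le0 !subr_eq0 => /eqP <- /eqP <-.
  by rewrite -scalerDl ab1 scale1r.
have d0 : 0 < `|u - v| by rewrite normr_gt0 subr_eq0.
set d := `|u - v| in d0 wu wv.
pose p := (b * d)^-1 *: (u - w); pose q := (a * d)^-1 *: (w - v).
have bd : 0 < b * d by rewrite mulr_gt0.
have ad : 0 < a * d by rewrite mulr_gt0.
have p1 : `|p| <= 1.
  by rewrite normrZ gtr0_norm ?invr_gt0// ler_pdivrMl// mulr1 distrC.
have q1 : `|q| <= 1.
  by rewrite normrZ gtr0_norm ?invr_gt0// ler_pdivrMl// mulr1.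
have pE : (b * d) *: p = u - w by rewrite scalerA mulfV ?gt_eqF// scale1r.
have qE : (a * d) *: q = w - v by rewrite scalerA mulfV ?gt_eqF// scale1r.
have epq : (b * d) *: p + (a * d) *: q = u - v by rewrite pE qE addrA subrK.
clearbody p q.
have z1 : `|b *: p + a *: q| = 1.
  apply: (mulfI (lt0r_neq0 d0)); rewrite -{1}(gtr0_norm d0) -normrZ.
  by rewrite scalerDr !scalerA ![d * _]mulrC epq mul1r.
have [_ ext] := scX _ z1.
have pq : p = q.
  apply: (ext p q b) => //; first by lra.
  by congr (_ + _ *: _); lra.
have : d *: p = u - v.
  by rewrite -epq -pq -scalerDl -mulrDl addrC ab1 mul1r.
move=> dp; have : u - w = b *: (u - v).
  by rewrite -dp scalerA.
move/eqP; rewrite subr_eq addrC -subr_eq => /eqP <-.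
have -> : a = 1 - b by lra.
by rewrite scalerBl scale1r scalerBr opprB addrA addrAC.
Qed.

End StrictConvexity.

End NormedSpaces.

(** * Compact open sets *)
Section ClopenBasis.
Context {K : topologicalType}.
Implicit Types (A B U V W Z : set K).

(** Near-covering compactness, along the filter generated by the families of subsets of members of
    [D], replaces the choice of a finite subcover and the intersection of the corresponding
    members. *)
Lemma compact_misses_base Z (D : set (set K)) : compact Z -> D !=set0 ->
  (forall A B, D A -> D B -> D (A `&` B)) ->
  (forall y, Z y -> exists2 A, D A & nbhs y (~` A)) ->
  exists2 A, D A & Z `<=` ~` A.
Proof.
move=> /compact_near_coveringP cZ [A0 DA0] DI ZD.
pose F := filter_from D (fun A => [set B | B `<=` A]).
have FF : Filter F.
  apply: filter_from_filter; first by exists A0.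
  move=> A B DA DB; exists (A `&` B); first exact: DI.
  by move=> C CAB; split=> x /CAB[].
have [|A DA AZ] := cZ _ F (fun A y => ~ A y) FF.
  move=> y /ZD[A DA yA]; exists (~` A, [set B | B `<=` A]).
    by split=> //; exists A.
  by move=> [x B] [/= Ax BA] /BA.
by exists A => //; exact: AZ.
Qed.

Hypothesis hK : hausdorff_space K.

Lemma compact_point_separated B x : compact B -> ~ B x ->
  exists2 U, nbhs x U & B `<=` ~` closure U.
Proof.
move=> cB nBx.
pose D := [set A | closed A /\ nbhs x A].
have [| |y By|A [clA xA] BA] := compact_misses_base B D cB.
- by exists setT; split; [exact: closedT|exact: filterT].
- by move=> A A' [? ?] [? ?]; split; [exact: closedI|exact: filterI].
- have xy : x != y by apply: contra_notN nBx => /eqP ->.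
  have := hK; rewrite open_hausdorff => /(_ _ _ xy)[[U V]] /= [xU yV] [oU oV /eqP UV].
  rewrite !inE in xU yV.
  exists (closure U); first by split; [exact: closed_closure|
    apply: filterS (@subset_closure _ U) _; exact: open_nbhs_nbhs].
  apply: filterS (open_nbhs_nbhs (conj oV yV)) => z Vz Uz.
  have [w [Uw Vw]] := Uz V (open_nbhs_nbhs (conj oV Vz)).
  by have : (U `&` V) w by []; rewrite UV.
by exists A; rewrite // -(closure_id A).1.
Qed.

Lemma compact_separated A B : compact A -> compact B -> A `&` B = set0 ->
  exists U V, [/\ open U, open V, A `<=` U, B `<=` V & U `&` V = set0].
Proof.
move=> cA cB AB.
pose D := [set C | closed C /\ exists V, [/\ open V, B `<=` V & V `<=` C]].
have [| |x Ax|C [clC [V [oV BV VC]]] AC] := compact_misses_base A D cA.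
- by exists setT; split; [exact: closedT|exists setT; split => //; exact: openT].
- move=> C C' [clC [V [oV BV VC]]] [clC' [V' [oV' BV' VC']]].
  split; first exact: closedI.
  exists (V `&` V'); split; [exact: openI|by move=> y By; split; [exact: BV|exact: BV']|].
  exact: setISS.
- have [|U xU BU] := compact_point_separated B x cB.
    by move=> Bx; have : (A `&` B) x by []; rewrite AB.
  have oU : open (~` closure U) by exact: closed_openC (@closed_closure _ U).
  exists (~` U°).
    split; first exact: open_closedC (@open_interior _ U).
    exists (~` closure U); split=> // y yU; apply: contra_not yU.
    by move=> /interior_subset; exact: subset_closure.
  by rewrite setCK; exact: nbhs_interior.
exists (~` C), V; split => //; first exact: closed_openC.
by apply/seteqP; split=> // y [Cy /VC].
Qed.

Hypothesis lK : locally_compact [set: K].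
Hypothesis tK : totally_disconnected [set: K].

(* Inside a compact neighbourhood of [t], the intersection [Q] of the relatively
   clopen sets around [t] is connected, hence reduced to [t]. *)
Lemma compact_open_basis t U : nbhs t U ->
  exists W, [/\ compact W, open W, W t & W `<=` U].
Proof.
move=> tU; have [W tW [cW clW]] : exists2 W, nbhs t W & compact W /\ closed W.
  by have [W] := lK t I; rewrite withinET => tW [cW clW]; exists W.
pose D := [set C | [/\ closed C, C t & exists2 G, open G & C = W `&` G]].
have DI C C' : D C -> D C' -> D (C `&` C').
  move=> [clC Ct [G oG eC]] [clC' Ct' [G' oG' eC']].
  split; [exact: closedI|by []|exists (G `&` G'); first exact: openI].
  by rewrite eC eC' setIACA setIid.
have DW : D W.
  by split=> //; [exact: nbhs_singleton|exists setT; [exact: openT|rewrite setIT]].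
pose Q := [set x | forall C, D C -> C x].
have QW : Q `<=` W by move=> x /(_ _ DW).
have Qt : Q t by move=> C [].
(* By compactness, a set disjoint from [Q] is already missed by one relatively clopen set. *)
have leave Z : compact Z -> Z `&` Q = set0 -> exists2 C, D C & Z `<=` ~` C.
  move=> cZ ZQ; apply: compact_misses_base => //; first by exists W.
  move=> y Zy; have nQy : ~ Q y by move=> Qy; have : (Z `&` Q) y by []; rewrite ZQ.
  have /existsNP[C /not_implyP[DC nCy]] := nQy.
  exists C => //; case: DC => clC _ _; apply: open_nbhs_nbhs; split=> //.
  exact: closed_openC.
have clQ : closed Q.
  move=> x clx C DC; have [clC _ _] := DC; apply: clC.
  by move=> V /clx[z [Qz Vz]]; exists z; split=> //; exact: Qz.
have Qcpt A : closed A -> compact (Q `&` A).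
  move=> clA; apply: (subclosed_compact _ cW); first exact: closedI.
  by move=> x [/QW].
(* Open sets [N1] and [N2] separate the two compact pieces, and some [C] in [D] lies in their union.
   Then [C] meets [N1] in the closed set [C] minus [N2], so this intersection is again in [D] and
   contains [Q]. *)
have Qsplit A B : closed A -> closed B -> Q `&` A `&` B = set0 -> A t ->
    Q `<=` A `|` B -> Q `<=` A.
  move=> clA clB AB0 At QAB.
  have [| | |N1 [N2 [oU oV AN1 BN2 dN]]] := compact_separated (Q `&` A) (Q `&` B).
  - exact: Qcpt.
  - exact: Qcpt.
  - by rewrite -subset0 -AB0 => x [[? ?] [? ?]].
  have [||C [clC Ct [G oG eC]] ZC] := leave (W `&` ~` (N1 `|` N2)).
  - apply: (subclosed_compact _ cW); last by move=> x [].
    by apply: closedI => //; apply: open_closedC; exact: openU.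
  - apply/seteqP; split=> // x [[Wx ndNx] Qx]; apply: ndNx.
    by have [Ax|Bx] := QAB x Qx; [left; apply: AN1|right; apply: BN2].
  have CdN : C `<=` N1 `|` N2.
    move=> x Cx; apply: contrapT => ndNx; apply: (ZC x) => //; split=> //.
    by move: Cx; rewrite eC => -[].
  have DCN1 : D (C `&` N1).
    split.
    - have -> : C `&` N1 = C `&` ~` N2.
        apply/seteqP; split=> x [Cx h]; split=> //.
          by move=> Vx; have : (N1 `&` N2) x by []; rewrite dN.
        by have [] := CdN x Cx.
      by apply: closedI => //; exact: open_closedC.
    - by split=> //; apply: AN1.
    - by exists (G `&` N1); [exact: openI|rewrite eC setIA].
  move=> x Qx; have [//|Bx] := QAB x Qx.
  have [_ Ux] := Qx _ DCN1; have Vx : N2 x by apply: BN2.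
  by have : (N1 `&` N2) x by []; rewrite dN.
have conQ : connected Q.
  move=> B [b Bb] [G oG eG] [P clP eP].
  have BQ : B `<=` Q by move=> x; rewrite eG => -[].
  have clB : closed B by rewrite eP; exact: closedI.
  have QB x : Q x -> ~ B x -> (~` G) x.
    by move=> Qx nBx Gx; apply: nBx; rewrite eG.
  have clG : closed (~` G) by exact: open_closedC.
  have BGz : Q `&` B `&` ~` G = set0.
    by apply/seteqP; split=> // x [[_]]; rewrite {1}eG => -[_ Gx] /(_ Gx).
  have QBGz : Q `<=` B `|` ~` G.
    by move=> x Qx; have [Bx|nBx] := pselect (B x); [left|right; exact: QB].
  have [Bt|nBt] := pselect (B t).
    by apply/seteqP; split=> //; exact: Qsplit BGz _ _.
  have /(_ b (BQ _ Bb)) nGb : Q `<=` ~` G.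
    apply: (Qsplit _ B) => //; first by rewrite setIAC.
      exact: QB.
    by rewrite setUC.
  by move: Bb; rewrite eG => -[_ /nGb].
have Qt1 x : Q x -> x = t.
  by move=> Qx; have := tK t I; move/seteqP => [+ _]; apply; exists Q.
(* Since [Q] reduces to [t], some [C] in [D] lies in [O]; being relatively open and inside the
   interior of [W], it is open in [K]. *)
pose O := U° `&` W°.
have [||C [clC Ct [G oG eC]] WC] := leave (W `&` ~` O).
- apply: (subclosed_compact _ cW); last by move=> x [].
  by apply: closedI => //; apply: open_closedC; apply: openI; exact: open_interior.
- apply/seteqP; split=> // x [[Wx nOx] /Qt1 xt]; apply: nOx; rewrite xt.
  by split; exact: nbhs_singleton (nbhs_interior _).
have CW : C `<=` W by rewrite eC => x [].
have CO : C `<=` O.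
  by move=> x Cx; apply: contrapT => nOx; apply: (WC x) => //; split=> //; exact: CW.
exists C; split=> //; first exact: (subclosed_compact clC cW).
  have -> : C = O `&` G.
    apply/seteqP; split=> x.
      by move=> Cx; split; [exact: CO|move: Cx; rewrite eC => -[]].
    by rewrite eC => -[[_ /interior_subset Wx] Gx].
  by apply: openI => //; apply: openI; exact: open_interior.
by move=> x /CO[/interior_subset].
Qed.

End ClopenBasis.

(** * Functions vanishing at infinity *)
Section C0Functions.
Context {R : realType} {X : normedModType R} {K : topologicalType}.
Implicit Types (f g : K -> X) (U : set K).

(** Boundedness makes [supnorm] a true supremum instead of the default value of [sup]. *)
Lemma C0_bounded f : C0 K X f -> exists c, forall t, `|f t| <= c.
Proof.
move=> [cf fC]; have [C [cC Ce]] := fC 1 ltr01.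
have [[c0 Cc0]|C0] := pselect (C !=set0); last first.
  by exists 1 => t; apply/ltW/Ce => Ct; apply: C0; exists t.
have [||c /set_mem Cc cmax] := @compact_EVT_max K R (fun t => `|f t|) C _ cC.
- by exists c0.
- by apply: continuous_subspaceT => t; apply: cvg_norm; exact: cf.
exists (1 + `|f c|) => t; have [Ct|nCt] := pselect (C t).
  by apply: (le_trans (cmax t (mem_set Ct))); rewrite lerDr.
by apply: (le_trans (ltW (Ce t nCt))); rewrite lerDl.
Qed.

Lemma C0_le_supnorm f t : C0 K X f -> `|f t| <= supnorm K X f.
Proof.
move=> /C0_bounded[c fc]; apply: sup_upper_bound; last by exists t.
by split; [exists `|f t|, t|exists c => _ [r _ <-]].
Qed.

Lemma supnorm_le f (t : K) c : (forall t, `|f t| <= c) -> supnorm K X f <= c.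
Proof. by move=> fc; apply: ge_sup; [exists `|f t|, t|move=> _ [r _ <-]]. Qed.

Lemma supnorm_max f s : (forall t, `|f t| <= `|f s|) -> supnorm K X f = `|f s|.
Proof.
move=> fs; apply/eqP; rewrite eq_le supnorm_le//=.
apply: sup_upper_bound; last by exists s.
by split; [exists `|f s|, s|exists `|f s| => _ [r _ <-]].
Qed.

Lemma C0_attains f (t0 : K) : C0 K X f -> exists s, supnorm K X f = `|f s|.
Proof.
move=> C0f; have [f0|/existsNP[t1 /eqP ft1]] := pselect (forall t, f t = 0).
  by exists t0; apply: supnorm_max => t; rewrite !f0.
(* Off the compact set given by this threshold the values are smaller than at [t1], so the maximum
   over that set is global. *)
have e0 : 0 < `|f t1| by rewrite normr_gt0.
have [cf fC] := C0f; have [C [cC Ce]] := fC _ e0.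
have Ct1 : C t1 by apply: contrapT => /Ce; rewrite ltxx.
have [||s /set_mem Cs smax] := @compact_EVT_max K R (fun t => `|f t|) C _ cC.
- by exists t1.
- by apply: continuous_subspaceT => t; apply: cvg_norm; exact: cf.
exists s; apply: supnorm_max => t.
have [Ct|nCt] := pselect (C t); first exact/smax/mem_set.
exact: le_trans (ltW (Ce t nCt)) (smax _ (mem_set Ct1)).
Qed.

Lemma C0_cst0 : C0 K X (fun=> 0).
Proof.
split; first by move=> t; exact: cvg_cst.
by move=> e e0; exists set0; split=> [|t _]; [exact: compact0|rewrite normr0].
Qed.

Lemma C0_linear (a : R) f g : C0 K X f -> C0 K X g ->
  C0 K X (fun t => a *: f t + g t).
Proof.
move=> [cf fC] [cg gC]; split.
  by move=> t; apply: cvgD; [apply: cvgZr; exact: cf|exact: cg].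
move=> e e0; have a0 : 0 < `|a| + 1 by rewrite ltr_wpDl.
have e2 : 0 < e / 2 by rewrite divr_gt0.
have [C [cC Ce]] := fC _ (divr_gt0 e2 a0); have [C' [cC' Ce']] := gC _ e2.
exists (C `|` C'); split; first exact: compactU.
move=> t /not_orP[/Ce ft /Ce' gt]; apply: le_lt_trans (ler_normD _ _) _.
rewrite [e]splitr; apply: ltrD => //; rewrite normrZ.
rewrite ltr_pdivlMr// in ft; apply: le_lt_trans ft.
by rewrite mulrC ler_wpM2l// lerDl.
Qed.

Lemma C0_sub f g : C0 K X f -> C0 K X g -> C0 K X (fun t => f t - g t).
Proof.
move=> C0f C0g; have := C0_linear (-1) _ _ C0g C0f.
by under eq_fun do rewrite scaleN1r addrC.
Qed.

Lemma C0_scale (a : R) f : C0 K X f -> C0 K X (fun t => a *: f t).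
Proof.
move=> C0f; have := C0_linear a _ _ C0f C0_cst0.
by under eq_fun do rewrite addr0.
Qed.

Definition const_on U (v : X) f : K -> X := fun t => if t \in U then v else f t.

Lemma const_on_in U v f t : U t -> const_on U v f t = v.
Proof. by move=> Ut; rewrite /const_on mem_set. Qed.

Lemma const_on_out U v f t : ~ U t -> const_on U v f t = f t.
Proof. by move=> nUt; rewrite /const_on memNset. Qed.

(** A compact open set of a Hausdorff space is clopen, so continuity is checked separately on [U]
    and off it. *)
Lemma C0_const_on U v f : hausdorff_space K -> compact U -> open U ->
  C0 K X f -> C0 K X (const_on U v f).
Proof.
move=> hK cU oU [cf fC]; split=> [t|e e0].
  have [Ut|nUt] := pselect (U t).
    apply/cvgrPdist_lt => e e0.
    apply: filterS (open_nbhs_nbhs (conj oU Ut)) => r Ur.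
    by rewrite !const_on_in// subrr normr0.
  apply/cvgrPdist_lt => e e0; rewrite const_on_out//.
  have oUC : open (~` U) by apply: closed_openC; exact: compact_closed.
  have := open_nbhs_nbhs (conj oUC nUt); have /cvgrPdist_lt/(_ _ e0) := cf t.
  by apply: filterS2 => r fr nUr; rewrite const_on_out.
have [C [cC Ce]] := fC _ e0.
exists (C `|` U); split; first exact: compactU.
by move=> t /not_orP[/Ce ft nUt]; rewrite const_on_out.
Qed.

Lemma sphere_le1 f t : C0_sphere K X f -> `|f t| <= 1.
Proof. by move=> [C0f <-]; exact: C0_le_supnorm. Qed.

Lemma sphere_intro f s : C0 K X f -> (forall t, `|f t| <= 1) -> `|f s| = 1 ->
  C0_sphere K X f.
Proof. by move=> C0f f1 fs; split=> //; rewrite (supnorm_max f s) => [//|t]; rewrite fs. Qed.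

Lemma sphere_attains f (t : K) : C0_sphere K X f -> exists s, `|f s| = 1.
Proof. by move=> [/(C0_attains _ t)[s fs] f1]; exists s; rewrite -fs. Qed.

End C0Functions.

(** * Cones spanned by a face *)
Section ConvexFaces.
Context {R : realType} {Y : normedModType R}.
Implicit Types (A : set Y) (u v w a : Y).

(** The cone spanned by the pairs [(a, 1)] with [a] in [A]; read as demands, it asks a functional to
    be at least 1 on [A]. *)
Inductive cone_of A : Y -> R -> Prop :=
| cone_of0 : cone_of A 0 0
| cone_ofD v c a b : cone_of A v c -> A a -> 0 < b ->
    cone_of A (v + b *: a) (c + b).

Lemma cone_of_convex A : convex_cone (cone_of A).
Proof.
split; first exact: cone_of0.
  move=> u v c d uc vd; elim: vd => [|w e a b _ IH Aa b0]; first by rewrite !addr0.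
  by rewrite !addrA; exact: cone_ofD.
move=> e u c e0 uc; elim: uc => [|w d a b _ IH Aa b0].
  by rewrite scaler0 mulr0; exact: cone_of0.
by rewrite scalerDr scalerA mulrDr; apply: cone_ofD => //; exact: mulr_gt0.
Qed.

Lemma cone_of1 A a : A a -> cone_of A a 1.
Proof.
by move=> Aa; have := cone_ofD _ _ _ _ 1 (cone_of0 A) Aa ltr01; rewrite scale1r !add0r.
Qed.

Lemma cone_ofS A A' v c : A `<=` A' -> cone_of A v c -> cone_of A' v c.
Proof.
move=> AA'; elim=> [|w d a b _ IH Aa b0]; first exact: cone_of0.
by apply: cone_ofD => //; exact: AA'.
Qed.

Lemma cone_of_ge0 A v c : cone_of A v c -> 0 <= c.
Proof. by elim=> // w d a b _ IH _ b0; rewrite addr_ge0// ltW. Qed.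

Lemma cone_of_norm_le A v c : (forall a, A a -> `|a| = 1) ->
  cone_of A v c -> `|v| <= c.
Proof.
move=> A1; elim=> [|w d a b _ IH Aa b0]; first by rewrite normr0.
by apply: le_trans (ler_normD _ _) _; rewrite normrZ (A1 a)// mulr1 gtr0_norm// lerD2r.
Qed.

(* Adding large multiples of [p + q] keeps the normalized partial sums at
   distance 2 from [- p] and [- q], so that the next summand can be absorbed. *)
Lemma cone_of_norm_ge A p q v c : `|p| = 1 -> `|q| = 1 -> 2 <= `|p + q| ->
  (forall a, A a -> `|a| = 1) ->
  (forall a, A a -> forall w, `|w| = 1 -> 2 <= `|w + p| -> 2 <= `|w + q| ->
     2 <= `|w + a|) ->
  cone_of A v c -> c <= `|v|.
Proof.
move=> p1 q1 pq A1 AH vc.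
suff H : forall M, 0 < M -> c + 2 * M <= `|v + M *: (p + q)|.
  have := H 1 ltr01; rewrite scale1r mulr1 => h.
  have := ler_normD v (p + q); have := ler_normD p q; rewrite p1 q1; lra.
elim: vc => [|{}v {}c a b vc' IH Aa b0] M M0.
  by rewrite !add0r normrZ gtr0_norm// mulrC ler_pM2l.
have c0 := cone_of_ge0 _ _ _ vc'.
set L := c + 2 * M; have L0 : 0 < L by rewrite /L; lra.
set u := v + M *: (p + q).
have uL : `|u| = L.
  apply/eqP; rewrite eq_le IH// andbT.
  apply: (le_trans (ler_normD _ _)); rewrite normrZ gtr0_norm// /L.
  have := cone_of_norm_le _ _ _ A1 vc'.
  have : M * `|p + q| <= M * 2.
    by rewrite ler_pM2l//; apply: le_trans (ler_normD _ _) _; rewrite p1 q1; lra.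
  lra.
(* The induction hypothesis at [M + L], less a summand of norm [L], leaves [c + 2 * M + L = 2 * L];
   division by [L] gives the distance 2 that [AH] requires. *)
have big : c + 2 * (M + L) <= `|u + L *: p + L *: q|.
  have -> : u + L *: p + L *: q = v + (M + L) *: (p + q).
    by rewrite [in RHS]scalerDl (scalerDr L) /u !addrA.
  by apply: IH; lra.
have uLE x : u + L *: x = L *: (L^-1 *: u + x).
  by rewrite scalerDr scalerA mulfV ?gt_eqF// scale1r.
have wx x y : `|y| = 1 -> c + 2 * (M + L) <= `|u + L *: x + L *: y| ->
    2 <= `|L^-1 *: u + x|.
  move=> y1 h; rewrite -(ler_pM2l L0) -{2}(gtr0_norm L0) -normrZ -uLE.
  have := ler_normD (u + L *: x) (L *: y); rewrite normrZ y1 gtr0_norm//.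
  by rewrite /L in h *; lra.
have w1 : `|L^-1 *: u| = 1 by rewrite normrZ uL gtr0_norm ?invr_gt0// mulVf ?gt_eqF.
have wa : 2 <= `|L^-1 *: u + a|.
  apply: AH => //; first exact: wx big.
  by apply: (wx q p) => //; rewrite addrAC.
have -> : v + b *: a + M *: (p + q) = L *: (L^-1 *: u) + b *: a.
  by rewrite scalerA mulfV ?gt_eqF// scale1r addrAC.
have := @norm_add_scale _ _ (L^-1 *: u) a L b (ltW L0) (ltW b0).
rewrite w1 (A1 a)// !mulr1 /L => h; rewrite [c + b]addrC -addrA [leLHS]addrC.
by apply: h; rewrite -[1 + 1]/(2 : R).
Qed.

End ConvexFaces.

(** * Isometries of the unit sphere *)
Section SphereIsometry.
Context {R : realType} {X : normedModType R} {K : topologicalType}.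
Context {Y : normedModType R} (D : (K -> X) -> Y).
Hypotheses (scX : strictly_convex X) (smX : smooth_points_dense X).
Hypotheses (tK : totally_disconnected [set: K]).
Hypotheses (lK : locally_compact [set: K]) (hK : hausdorff_space K).

Local Notation S := (C0_sphere K X).
Local Notation dist f g := (supnorm K X (fun t => f t - g t)).

Hypothesis DS : forall f, S f -> `|D f| = 1.
Hypothesis Diso : forall f g, S f -> S g -> `|D f - D g| = dist f g.
Hypothesis Dsurj : forall y, `|y| = 1 -> exists2 f, S f & D f = y.

(** * Distances between images and locally constant modifications *)

Lemma le_dist f g t : S f -> S g -> `|f t - g t| <= `|D f - D g|.
Proof.
move=> Sf Sg; rewrite Diso//.
by apply: (C0_le_supnorm (fun t => f t - g t)); apply: C0_sub; [case: Sf|case: Sg].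
Qed.

Lemma dist_le f g (t : K) c : S f -> S g -> (forall t, `|f t - g t| <= c) ->
  `|D f - D g| <= c.
Proof. by move=> Sf Sg fg; rewrite Diso//; exact: (supnorm_le _ t). Qed.

Lemma sphere_const_on U v f s : compact U -> open U -> `|v| <= 1 -> S f ->
  `|const_on U v f s| = 1 -> S (const_on U v f).
Proof.
move=> cU oU v1 Sf; apply: sphere_intro.
  by apply: C0_const_on => //; case: Sf.
move=> t; have [Ut|nUt] := pselect (U t); first by rewrite const_on_in.
by rewrite const_on_out//; exact: sphere_le1.
Qed.

Lemma sphere_peak U v t : compact U -> open U -> U t -> `|v| = 1 ->
  S (const_on U v (fun=> 0)).
Proof.
move=> cU oU Ut v1; apply: (sphere_intro _ t).
- by apply: C0_const_on => //; exact: C0_cst0.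
- move=> r; have [Ur|nUr] := pselect (U r); first by rewrite const_on_in// v1.
  by rewrite const_on_out// normr0.
- by rewrite const_on_in.
Qed.

Lemma flat_nbhd f t (V : set K) (e : R) : S f -> nbhs t V -> 0 < e ->
  exists U, [/\ compact U, open U, U t & forall r, U r -> V r /\ `|f r - f t| <= e].
Proof.
move=> [[cf _] _] tV e0.
have : nbhs t (V `&` [set r | `|f r - f t| <= e]).
  apply: filterI => //; have /cvgrPdist_le/(_ _ e0) := cf t.
  by apply: filterS => r; rewrite distrC.
move=> /(compact_open_basis hK lK tK)[U [cU oU Ut UV]].
by exists U; split.
Qed.

Lemma dist_const_on U v f (t : K) e : 0 <= e -> S f -> S (const_on U v f) ->
  (forall r, U r -> `|f r - v| <= e) -> `|D f - D (const_on U v f)| <= e.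
Proof.
move=> e0 Sf Sg Uf; apply: (dist_le _ _ t) => // r.
have [Ur|nUr] := pselect (U r); first by rewrite const_on_in//; exact: Uf.
by rewrite const_on_out// subrr normr0.
Qed.

(** Let [w = D k]. Off [U] the peak vanishes, so [k] is within 1 of it; on [U] it agrees with [g].
    If [D g] were closer to [w] than 2, so would be the image of the peak. *)
Lemma peak_dist U v t w g : compact U -> open U -> U t -> `|v| = 1 ->
  `|w| = 1 -> 2 <= `|w - D (const_on U v (fun=> 0))| ->
  S g -> (forall r, U r -> g r = v) -> 2 <= `|w - D g|.
Proof.
move=> cU oU Ut v1 /Dsurj[k Sk <-] far Sg gU; rewrite leNgt; apply/negP => near.
have Sp := sphere_peak _ _ _ cU oU Ut v1.
suff : `|D k - D (const_on U v (fun=> 0))| <= Num.max 1 `|D k - D g|.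
  by rewrite le_max => /orP[]; lra.
apply: (dist_le _ _ t) => // r; rewrite le_max; apply/orP.
have [Ur|nUr] := pselect (U r).
  by right; rewrite const_on_in// -(gU r)//; exact: le_dist.
by left; rewrite const_on_out// subr0; exact: sphere_le1.
Qed.

(** Both faces are prescribed because [D] is not yet known to be odd. *)
Definition adapted t (x : X) (phi : Y -> R) :=
  [/\ linear_form phi, forall y, phi y <= `|y|,
      forall g, S g -> g t = x -> phi (D g) = 1 &
      forall g, S g -> g t = - x -> phi (D g) = -1].

Lemma adaptedN t x phi : adapted t x phi -> adapted t (- x) (fun y => - phi y).
Proof.
move=> [lphi phin phi1 phiN1]; split=> [a u v|y|g Sg gt|g Sg gt].
- by rewrite lphi; lra.
- by rewrite -linear_formN// -(normrN y).
- by rewrite phiN1// opprK.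
- by rewrite phi1// gt opprK.
Qed.

(** A functional at least 1 on this set is at least 1 on the images for [x] and at most -1 on those
    for [- x]. Values are fixed on all of [U] so that [peak_dist] applies. *)
Definition germ_images U (x : X) : set Y :=
  [set y | (exists g, [/\ S g, forall r, U r -> g r = x & y = D g]) \/
           (exists g, [/\ S g, forall r, U r -> g r = - x & y = - D g])].

(** The peaks of values [x] and [- x] supply the two anchors of [cone_of_norm_ge], and [peak_dist]
    its absorption hypothesis. *)
Lemma cone_germ_images_norm U x t v c : compact U -> open U -> U t -> `|x| = 1 ->
  cone_of (germ_images U x) v c -> c <= `|v|.
Proof.
move=> cU oU Ut x1; have Nx1 : `|- x| = 1 by rewrite normrN.
have Sp := sphere_peak _ _ _ cU oU Ut x1.
have Sq := sphere_peak _ _ _ cU oU Ut Nx1.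
set p := const_on U x _ in Sp; set q := const_on U (- x) _ in Sq.
apply: (@cone_of_norm_ge _ _ _ (D p) (- D q)).
- exact: DS.
- by rewrite normrN DS.
- apply: le_trans (le_dist _ _ t Sp Sq).
  rewrite /p /q !const_on_in// opprK.
  have -> : x + x = 2 *: x by rewrite scaler_nat mulr2n.
  by rewrite normrZ x1 mulr1 ger0_norm.
- by move=> a [] [g [Sg _ ->]]; rewrite ?normrN DS.
- move=> a [] [g [Sg gU ->]] w w1 wp wq.
    rewrite -normrN opprD; apply: (peak_dist _ _ _ _ _ cU oU Ut x1) => //.
      by rewrite normrN.
    by rewrite -opprD normrN.
  exact: (peak_dist _ _ _ _ _ cU oU Ut Nx1).
Qed.

Lemma adapted_exists t x : `|x| = 1 -> exists phi, adapted t x phi.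
Proof.
move=> x1; have Nx1 : `|- x| = 1 by rewrite normrN.
pose nb U := [/\ compact U, open U & U t].
pose A := [set y | exists2 U, nb U & germ_images U x y].
have germS U V : U `<=` V -> germ_images V x `<=` germ_images U x.
  by move=> UV y [] [g [Sg gV ->]]; [left|right]; exists g; split=> // r /UV; exact: gV.
(* A combination involves finitely many neighbourhoods, hence lives on their intersection. *)
have coneA v c : cone_of A v c -> exists2 U, nb U & cone_of (germ_images U x) v c.
  elim=> [|{}v {}c a b _ [U [cU oU Ut] Uv] [V [cV oV Vt] Va] b0].
    have [U [cU oU Ut _]] := compact_open_basis hK lK tK _ _ (@filterT _ (nbhs t) _).
    by exists U => //; exact: cone_of0.
  exists (U `&` V).
    split; [|exact: openI|by []].
    apply: (subclosed_compact _ cU); last by move=> r [].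
    by apply: closedI; exact: compact_closed.
  apply: cone_ofD => //; last by apply: germS Va => r [].
  by apply: cone_ofS Uv; apply: germS => r [].
have [|phi [lphi phin phiA]] := hahn_banach_cone _ _ (@norm_sublinear _ Y)
    (cone_of_convex A).
  move=> v c /coneA[U [cU oU Ut]]; exact: (cone_germ_images_norm U x t).
exists phi; split=> // g Sg gt; apply/eqP; rewrite eq_le.
  rewrite -(DS _ Sg) phin /= DS//; apply/ler_addgt0Pr => e e0.
  (* Only [g t = x] is given; making [g] constant near [t] moves its image by at most [e], and [phi]
     is bounded by the norm. *)
  have [U [cU oU Ut Uf]] := flat_nbhd g t _ _ Sg filterT e0.
  have Sh : S (const_on U x g).
    by apply: (sphere_const_on _ _ _ t) => //; rewrite ?x1// const_on_in.
  have h1 : 1 <= phi (D (const_on U x g)).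
    apply: phiA; apply: cone_of1; exists U => //; left; exists (const_on U x g).
    by split=> // r Ur; rewrite const_on_in.
  have : `|D g - D (const_on U x g)| <= e.
    apply: (dist_const_on _ _ _ t) => // [|r /Uf[_]]; first exact: ltW.
    by rewrite gt.
  have := phin (D (const_on U x g) - D g); rewrite linear_formB// distrC; lra.
apply/andP; split; last first.
  by rewrite lerNl -linear_formN//; apply: le_trans (phin _) _; rewrite normrN DS.
apply/ler_addgt0Pr => e e0.
have [U [cU oU Ut Uf]] := flat_nbhd g t _ _ Sg filterT e0.
have Sh : S (const_on U (- x) g).
  by apply: (sphere_const_on _ _ _ t) => //; rewrite ?Nx1// const_on_in.
have h1 : 1 <= phi (- D (const_on U (- x) g)).
  apply: phiA; apply: cone_of1; exists U => //; right; exists (const_on U (- x) g).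
  by split=> // r Ur; rewrite const_on_in.
have : `|D g - D (const_on U (- x) g)| <= e.
  apply: (dist_const_on _ _ _ t) => // [|r /Uf[_]]; first exact: ltW.
  by rewrite gt.
rewrite linear_formN// in h1.
have := phin (D g - D (const_on U (- x) g)); rewrite linear_formB//; lra.
Qed.

(** [phi] is -1 at the image of [f] changed to [- x] near [t], and that image is within
    [|f t + x| + e] of [D f]. *)
Lemma adapted_le t x phi f : `|x| = 1 -> adapted t x phi -> S f ->
  phi (D f) <= `|f t + x| - 1.
Proof.
move=> x1 [lphi phin _ phiN1] Sf; apply/ler_addgt0Pr => e e0.
have [U [cU oU Ut Uf]] := flat_nbhd f t _ _ Sf filterT e0.
have Sg : S (const_on U (- x) f).
  by apply: (sphere_const_on _ _ _ t) => //; rewrite ?const_on_in// normrN x1.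
have := phin (D f - D (const_on U (- x) f)).
rewrite linear_formB// (phiN1 (const_on _ _ _))// ?const_on_in//.
have : `|D f - D (const_on U (- x) f)| <= `|f t + x| + e.
  apply: (dist_const_on _ _ _ t) => // [|r /Uf[_ ft]].
    by rewrite addr_ge0// ltW.
  have -> : f r - - x = (f t + x) + (f r - f t) by rewrite opprK [RHS]addrC addrA subrK.
  by apply: le_trans (ler_normD _ _) _; rewrite lerD2l.
lra.
Qed.

(** An adapted functional is 1 at the combination, which is thus a unit vector [D k]. Then
    [adapted_le] gives [2 <= |k t + x|], and strict convexity gives [k t = x]. *)
Lemma adapted_combination t x f g (a b : R) : `|x| = 1 -> S f -> S g ->
  f t = x -> g t = x -> 0 <= a -> 0 <= b -> a + b = 1 ->
  exists k, [/\ S k, D k = a *: D f + b *: D g & k t = x].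
Proof.
move=> x1 Sf Sg ft gt a0 b0 ab1.
have [phi aphi] := adapted_exists t x x1; have [lphi phin phi1 _] := aphi.
have phiy : phi (a *: D f + b *: D g) = 1.
  by rewrite lphi linear_formZ// !phi1// !mulr1.
have y1 : `|a *: D f + b *: D g| = 1.
  apply/eqP; rewrite eq_le; apply/andP; split; last by rewrite -phiy.
  apply: le_trans (ler_normD _ _) _.
  by rewrite !normrZ !DS// !mulr1 !ger0_norm// ab1.
have [k Sk Dk] := Dsurj _ y1; exists k; split=> //.
apply: strictly_convex_norm_add => //; first exact: sphere_le1.
  by rewrite x1.
by have := adapted_le _ _ _ _ x1 aphi Sk; rewrite Dk phiy; lra.
Qed.

(** [f] and [const_on U x f] agree at [s], so points between their images are images [D k]. As [f]
    is constant on [U], the two images are within [|f t - x|], and the distances from [k t] to [f t]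
    and [x] determine [k t]. *)
Lemma adapted_le_flat t x phi f U s (M : R) : `|x| = 1 -> adapted t x phi ->
  compact U -> open U -> U t -> (forall r, U r -> f r = f t) -> ~ U s ->
  S f -> `|f s| = 1 -> 1 < M -> phi (D f) <= `|M *: x + f t| - M.
Proof.
move=> x1 aphi cU oU Ut Uf nUs Sf fs M1.
have Sg : S (const_on U x f).
  by apply: (sphere_const_on _ _ _ t) => //; rewrite ?const_on_in// x1.
(* The weights satisfy [b + 1 = a * M], so that [k t + x] becomes [a *: (M *: x + f t)]. *)
pose a := 2 / (M + 1); pose b := (M - 1) / (M + 1).
have M0 : 0 < M + 1 by lra.
have a0 : 0 < a by rewrite divr_gt0.
have b0 : 0 < b by rewrite divr_gt0//; lra.
have ab1 : a + b = 1 by rewrite /a /b -mulrDl -[RHS](mulfV (lt0r_neq0 M0)); congr (_ / _); lra.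
have [|k [Sk Dk _]] := adapted_combination s (f s) f _ a b fs Sf Sg erefl _
  (ltW a0) (ltW b0) ab1; first by rewrite const_on_out.
set g := const_on U x f in Sg Dk.
have gt : g t = x by rewrite /g const_on_in.
have fg : `|D f - D g| <= `|f t - x|.
  by apply: (dist_const_on _ _ _ t) => // r Ur; rewrite Uf.
have kt : k t = a *: f t + b *: x.
  apply: strictly_convex_between => //.
  - apply: le_trans (le_dist _ _ t Sk Sf) _.
    have -> : D k - D f = b *: (D g - D f).
      rewrite Dk -[X in _ - X]scale1r -ab1 scalerDl opprD addrACA subrr add0r.
      by rewrite scalerBr.
    by rewrite normrZ gtr0_norm// distrC ler_pM2l.
  - rewrite -[in leLHS]gt; apply: le_trans (le_dist _ _ t Sk Sg) _.
    have -> : D k - D g = a *: (D f - D g).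
      rewrite Dk -[X in _ - X]scale1r -ab1 scalerDl opprD addrACA subrr addr0.
      by rewrite scalerBr.
    by rewrite normrZ gtr0_norm// ler_pM2l.
have := adapted_le _ _ _ _ x1 aphi Sk.
have [lphi _ phi1 _] := aphi.
rewrite Dk lphi linear_formZ// (phi1 g)// mulr1.
have -> : k t + x = a *: (M *: x + f t).
  rewrite kt scalerDr scalerA -addrA addrC; congr (_ + _).
  rewrite -[X in _ + X]scale1r -scalerDl; congr (_ *: _).
  by rewrite /a /b; field; lra.
rewrite normrZ gtr0_norm// => h.
rewrite -(ler_pM2l a0) mulrBr; move: h.
have -> : b = a * M - 1 by rewrite /a /b; field; lra.
lra.
Qed.

Lemma adapted_le_germ t x phi f s (M : R) : `|x| = 1 -> adapted t x phi ->
  S f -> s != t -> `|f s| = 1 -> 1 < M -> phi (D f) <= `|M *: x + f t| - M.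
Proof.
move=> x1 aphi Sf st fs M1; apply/ler_addgt0Pr => e e0.
have tNs : nbhs t (~` [set s]).
  apply: open_nbhs_nbhs; split; last by apply/eqP; rewrite eq_sym.
  by apply: closed_openC; apply: accessible_closed_set1; exact: hausdorff_accessible.
have [U [cU oU Ut Uf]] := flat_nbhd f t _ _ Sf tNs e0.
have nUs : ~ U s by move=> /Uf[+ _]; apply.
have gs : const_on U (f t) f s = f s by rewrite const_on_out.
have gt : const_on U (f t) f t = f t by rewrite const_on_in.
have Sg : S (const_on U (f t) f).
  by apply: (sphere_const_on _ _ _ s) => //; [exact: sphere_le1|rewrite gs].
have h : phi (D (const_on U (f t) f)) <= `|M *: x + const_on U (f t) f t| - M.
  apply: (adapted_le_flat t x phi _ U s) => //; last by rewrite gs.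
  by move=> r Ur; rewrite !const_on_in.
rewrite gt in h.
have : `|D f - D (const_on U (f t) f)| <= e.
  by apply: (dist_const_on _ _ _ t) => // [|r /Uf[]//]; exact: ltW.
have [lphi phin _ _] := aphi.
have := phin (D f - D (const_on U (f t) f)); rewrite linear_formB//; lra.
Qed.

(** The last clause of [smooth_support] turns the bounds for all [M] into the upper estimate; the
    pair [- x], [- phi] gives the lower one. *)
Lemma adapted_off t x phi xs f s : `|x| = 1 -> adapted t x phi ->
  smooth_support x xs -> S f -> s != t -> `|f s| = 1 -> phi (D f) = xs (f t).
Proof.
move=> x1 aphi [lxs _ _ xsP] Sf st fs.
have bound (M : R) x' phi' : `|x'| = 1 -> adapted t x' phi' ->
    phi' (D f) <= `|M *: x' + f t| - M.
  (* [adapted_le_germ] needs a coefficient above 1; [|M| + 2] is above both 1 and [M]. *)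
  move=> x1' aphi'; apply: (@le_trans _ _ (`|(`|M| + 2) *: x' + f t| - (`|M| + 2))).
    by apply: (adapted_le_germ t x' phi' f s) => //; rewrite ltr_wpDl// ltr1n.
  by apply: norm_addZ_le => //; have := ler_norm M; lra.
apply/eqP; rewrite eq_le; apply/andP; split.
  by apply: xsP => M _; exact: bound.
rewrite -lerN2 -(linear_formN _ (f t) lxs); apply: xsP => M _.
have -> : M *: x + - f t = - (M *: - x + f t) by rewrite scalerN opprD opprK.
rewrite normrN; apply: (bound M (- x) (fun y => - phi y)); first by rewrite normrN.
exact: adaptedN.
Qed.

(** The support functional of a smooth point within 1/2 of the normalised [v] exceeds 1/2 there. *)
Lemma smooth_separates (v : X) : v != 0 -> exists x xs,
  [/\ `|x| = 1, smooth_support x xs & 0 < xs v].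
Proof.
move=> v0; have v1 : `| `|v|^-1 *: v| = 1.
  by rewrite normrZ normfV normr_id mulVf// normr_eq0.
have [x [smx xv]] := smX _ v1 2^-1 ltac:(lra).
have x1 : `|x| = 1 by case: smx.
have [xs sxs] := smooth_pointP _ smx; exists x, xs; split=> //.
have [lxs xsn xsx _] := sxs.
have : 0 < xs (`|v|^-1 *: v).
  have := xsn (x - `|v|^-1 *: v); rewrite linear_formB// xsx distrC; lra.
by rewrite linear_formZ// pmulr_rgt0// invr_gt0 normr_gt0.
Qed.

(** * Functions attaining their norm only at the evaluation point *)

Hypothesis K2 : exists a b : K, a <> b.

(** [f] is a convex combination of [f1] and [f2], which have norm 1 at [s], so that [adapted_off]
    evaluates both at [t]. The same combination of their images is some [D k]; functionals at the
    points other than [t] show [k = f]. *)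
Lemma adapted_on_flat t x phi xs f U s : `|x| = 1 -> adapted t x phi ->
  smooth_support x xs -> S f -> `|f t| = 1 -> compact U -> open U -> U s ->
  ~ U t -> (forall r, U r -> f r = f s) -> phi (D f) = xs (f t).
Proof.
move=> x1 aphi sxs Sf ft cU oU Us nUt Uf.
have st : s != t by apply: contra_notN nUt => /eqP <-.
pose c := `|f s|.
have [e e1 ce] : exists2 e : X, `|e| = 1 & f s = c *: e.
  have [fs0|fs0] := eqVneq (f s) 0.
    by exists x => //; rewrite /c fs0 normr0 scale0r.
  exists (c^-1 *: f s); first by rewrite normrZ normfV normr_id mulVf// normr_eq0.
  by rewrite scalerA mulfV ?scale1r// normr_eq0.
have c0 : 0 <= c by rewrite normr_ge0.
have c1 : c <= 1 by exact: sphere_le1.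
pose f1 := const_on U e f; pose f2 := const_on U (- e) f.
have f1t : f1 t = f t by rewrite /f1 const_on_out.
have f2t : f2 t = f t by rewrite /f2 const_on_out.
have Ne1 : `|- e| = 1 by rewrite normrN.
have S1 : S f1 by apply: (sphere_const_on _ _ _ t); rewrite -/f1 ?f1t ?e1.
have S2 : S f2 by apply: (sphere_const_on _ _ _ t); rewrite -/f2 ?f2t ?Ne1.
have f1s : `|f1 s| = 1 by rewrite /f1 const_on_in.
have f2s : `|f2 s| = 1 by rewrite /f2 const_on_in.
(* [a - b = c], so the values [e] and [- e] combine to [f s]. *)
pose a := (1 + c) / 2; pose b := (1 - c) / 2.
have a0 : 0 <= a by rewrite /a; lra.
have b0 : 0 <= b by rewrite /b; lra.
have ab1 : a + b = 1 by rewrite /a /b; lra.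
have f12 r : a *: f1 r + b *: f2 r = f r.
  have [Ur|nUr] := pselect (U r).
    rewrite /f1 /f2 !const_on_in// (Uf r Ur) ce scalerN -scalerBl.
    by congr (_ *: _); rewrite /a /b; lra.
  by rewrite /f1 /f2 !const_on_out// -scalerDl ab1 scale1r.
have [k [Sk Dk kt]] := adapted_combination t (f t) f1 f2 a b ft S1 S2 f1t f2t a0 b0 ab1.
have comb r z psi zs : `|z| = 1 -> adapted r z psi -> smooth_support z zs ->
    psi (D f1) = zs (f1 r) -> psi (D f2) = zs (f2 r) -> psi (D k) = zs (f r).
  move=> z1 [lpsi _ _ _] [lzs _ _ _] h1 h2.
  by rewrite Dk lpsi (linear_formZ psi)// h1 h2 -(f12 r) lzs (linear_formZ zs).
have kf : k = f.
  (* For [r] other than [t], [adapted_off] evaluates [k], [f1] and [f2] at [r], since all three have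
     norm 1 at [t]. *)
  apply/funext => r; have [->//|rt] := eqVneq r t.
  apply/eqP; rewrite -subr_eq0; apply: contrapT => /negP /smooth_separates.
  move=> [z [zs [z1 szs]]]; have [psi apsi] := adapted_exists r z z1.
  have [lzs _ _ _] := szs; rewrite linear_formB//.
  rewrite -(adapted_off r z psi zs k t) ?kt// 1?eq_sym//.
  rewrite (comb r z psi zs)// ?subrr ?ltxx//.
    by apply: (adapted_off r z psi zs f1 t) => //; rewrite 1?eq_sym// f1t.
  by apply: (adapted_off r z psi zs f2 t) => //; rewrite 1?eq_sym// f2t.
rewrite -kf in Sf *.
rewrite kt; apply: (comb t x) => //; first exact: (adapted_off t x phi xs f1 s).
exact: (adapted_off t x phi xs f2 s).
Qed.

(** If the chosen maximum point is [t] itself, [f] is approximated by functions constant near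
    another point [s], where [adapted_on_flat] applies. *)
Lemma adaptedE t x phi xs f : `|x| = 1 -> adapted t x phi ->
  smooth_support x xs -> S f -> phi (D f) = xs (f t).
Proof.
move=> x1 aphi sxs Sf.
have [r fr] := sphere_attains _ t Sf.
have [rt|rt] := eqVneq r t; last exact: (adapted_off t x phi xs f r).
rewrite rt in fr.
have [s st] : exists s, s != t.
  have [a [b /eqP ab]] := K2; have [at_|] := eqVneq a t; last by exists a.
  by exists b; rewrite -at_ eq_sym.
have [lphi phin _ _] := aphi; have [lxs _ _ _] := sxs.
have close (e : R) : 0 < e -> `|phi (D f) - xs (f t)| <= e.
  move=> e0.
  have sNt : nbhs s (~` [set t]).
    apply: open_nbhs_nbhs; split; last exact/eqP.
    by apply: closed_openC; apply: accessible_closed_set1; exact: hausdorff_accessible.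
  have [U [cU oU Us Uf]] := flat_nbhd f s _ _ Sf sNt e0.
  have nUt : ~ U t by move=> /Uf[+ _]; apply.
  have gt : const_on U (f s) f t = f t by rewrite const_on_out.
  have gs : const_on U (f s) f s = f s by rewrite const_on_in.
  have Sg : S (const_on U (f s) f).
    by apply: (sphere_const_on _ _ _ t) => //; [exact: sphere_le1|rewrite gt].
  rewrite -gt -(adapted_on_flat t x phi xs _ U s x1 aphi sxs Sg) ?gt// => [|q Uq].
    rewrite -linear_formB//; apply: le_trans (form_norm_le _ _ lphi phin) _.
    by apply: (dist_const_on _ _ _ t) => // [|q /Uf[]//]; exact: ltW.
  by rewrite gs const_on_in.
by apply/eqP; rewrite -subr_eq0 -normr_le0; apply/ler_addgt0Pr => e /close; rewrite add0r.
Qed.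

(** A nonzero [y] is a positive multiple of some [D f] with [|f t| = 1]; a support functional
    positive at [f t] then yields an adapted [phi] positive at [y]. *)
Lemma adapted_separates (y : Y) : (forall t x xs phi, `|x| = 1 ->
  smooth_support x xs -> adapted t x phi -> phi y = 0) -> y = 0.
Proof.
move=> H; apply/eqP; apply: contrapT => /negP y0.
have y1 : `| `|y|^-1 *: y| = 1 by rewrite normrZ normfV normr_id mulVf// normr_eq0.
have [f Sf Df] := Dsurj _ y1; have [t0 _] := K2.
have [t ft] := sphere_attains _ t0 Sf.
have ft0 : f t != 0 by rewrite -normr_gt0 ft.
have [x [xs [x1 sxs]]] := smooth_separates _ ft0.
have [phi aphi] := adapted_exists t x x1.
rewrite -(adaptedE t x phi)// Df; have [lphi _ _ _] := aphi.
by rewrite linear_formZ// (H t x xs phi)// mulr0 ltxx.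
Qed.

(** * The homogeneous extension *)

Definition radial_extension (f : K -> X) : Y :=
  supnorm K X f *: D (fun t => (supnorm K X f)^-1 *: f t).

Local Notation T := radial_extension.

Lemma sphere_normalize f : C0 K X f -> supnorm K X f != 0 ->
  S (fun t => (supnorm K X f)^-1 *: f t).
Proof.
move=> C0f f0; have [t0 _] := K2; have [s fs] := C0_attains _ t0 C0f.
have fp : 0 < supnorm K X f by rewrite lt0r f0 fs normr_ge0.
apply: (sphere_intro _ s); first exact: C0_scale.
  move=> t; rewrite normrZ gtr0_norm ?invr_gt0// ler_pdivrMl// mulr1.
  exact: C0_le_supnorm.
by rewrite normrZ gtr0_norm ?invr_gt0// -fs mulVf.
Qed.

Lemma adapted_radial t x xs phi f : `|x| = 1 -> smooth_support x xs ->
  adapted t x phi -> C0 K X f -> phi (T f) = xs (f t).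
Proof.
move=> x1 sxs aphi C0f; have [lphi _ _ _] := aphi; have [lxs _ _ _] := sxs.
rewrite linear_formZ//; have [f0|f0] := eqVneq (supnorm K X f) 0.
  (* At norm 0 the scalar factor vanishes, whatever value [D] takes off the sphere. *)
  have /eqP -> : f t == 0 by rewrite -normr_le0 -f0; exact: C0_le_supnorm.
  by rewrite f0 mul0r linear_form0.
rewrite (adaptedE t x phi xs _ x1 aphi sxs (sphere_normalize _ C0f f0)).
by rewrite linear_formZ// mulrA mulfV// mul1r.
Qed.

Lemma radial_linear (a : R) f g : C0 K X f -> C0 K X g ->
  T (fun t => a *: f t + g t) = a *: T f + T g.
Proof.
move=> C0f C0g; apply/eqP; rewrite -subr_eq0; apply/eqP.
apply: adapted_separates => t x xs phi x1 sxs aphi.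
have [lphi _ _ _] := aphi; have [lxs _ _ _] := sxs.
rewrite linear_formB// lphi !(adapted_radial t x xs)//; last exact: C0_linear.
by rewrite lxs subrr.
Qed.

Lemma radial_norm f : C0 K X f -> `|T f| = supnorm K X f.
Proof.
move=> C0f; have [t0 _] := K2; have [s fs] := C0_attains _ t0 C0f.
rewrite normrZ {1}fs normr_id -fs; have [f0|f0] := eqVneq (supnorm K X f) 0.
  by rewrite f0 mul0r.
by rewrite DS ?mulr1//; exact: sphere_normalize.
Qed.

Lemma radial_sphere f : S f -> T f = D f.
Proof.
move=> [_ f1]; rewrite /T f1 scale1r; congr D; apply/funext => t.
by rewrite invr1 scale1r.
Qed.

Lemma radial_isometry f g : C0 K X f -> C0 K X g -> `|T f - T g| = dist f g.
Proof.
move=> C0f C0g; rewrite -(radial_norm _ (C0_sub _ _ C0f C0g)); congr `|_|.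
have := radial_linear (-1) _ _ C0g C0f.
under eq_fun do rewrite scaleN1r addrC.
by move=> ->; rewrite scaleN1r addrC.
Qed.

Lemma radial_surjective y : exists2 f, C0 K X f & T f = y.
Proof.
have T0 : T (fun=> 0) = 0.
  apply/eqP; rewrite -normr_eq0 radial_norm; last exact: C0_cst0.
  have [t0 _] := K2; rewrite (supnorm_max _ t0) ?normr0//.
have [->|y0] := eqVneq y 0; first by exists (fun=> 0) => //; exact: C0_cst0.
have y1 : `| `|y|^-1 *: y| = 1 by rewrite normrZ normfV normr_id mulVf// normr_eq0.
have [f Sf Df] := Dsurj _ y1; have C0f : C0 K X f by case: Sf.
exists (fun t => `|y| *: f t); first exact: C0_scale.
have := radial_linear `|y| _ _ C0f C0_cst0.
under eq_fun do rewrite addr0.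
by move=> ->; rewrite T0 addr0 radial_sphere// Df scalerA mulfV ?scale1r// normr_eq0.
Qed.

End SphereIsometry.

Theorem theorem4p4 (R : realType) (X : completeNormedModType R)
  (K : topologicalType) :
  strictly_convex X -> dim_ge2 X -> smooth_points_dense X ->
  totally_disconnected [set: K] -> locally_compact [set: K] ->
  hausdorff_space K -> (exists a b : K, a <> b) ->
  C0_MazurUlam K X.
Proof.
move=> scX _ smX tK lK hK K2 Y D DS Diso Dsurj.
exists (radial_extension D); split.
- by move=> a f g; exact: (radial_linear D scX smX tK lK hK DS Diso Dsurj K2).
- by move=> f g; exact: (radial_isometry D scX smX tK lK hK DS Diso Dsurj K2).
- exact: (radial_surjective D scX smX tK lK hK DS Diso Dsurj K2).
- exact: radial_sphere.
Qed.
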